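(* Let $X$ and $Y$ be Banach spaces. If either $X$ or $Y$ has the Radon-Nikodým property, then the set of uniquely quasi norm attaining operators from $X$ to $Y$ is dense in $\mathcal{L}(X,Y)$.
   Context: Banach spaces are over $\mathbb{K}=\mathbb{R}$ or $\mathbb{C}$; $\mathbb{T}=\{\theta\in\mathbb{K}:|\theta|=1\}$; $B_X$ is the closed unit ball of $X$; $\mathcal{L}(X,Y)$ is the space of bounded linear operators with the operator norm. An operator $T\in\mathcal{L}(X,Y)$ is uniquely quasi norm attaining if there is $u\in Y$ such that every sequence $(x_n)\subset B_X$ with $\|Tx_n\|\to\|T\|$ has a subsequence $(x_{\sigma(n)})$ with $Tx_{\sigma(n)}\to\theta u$ for some $\theta\in\mathbb{T}$. A Banach space has the Radon-Nikodým property (RNP) if every nonempty bounded subset of it is dentable, where a set $A$ is dentable if for every $\delta>0$ there is $a\in A$ not belonging to the closed convex hull of $A\setminus\{b:\|b-a\|<\delta\}$. *)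

(* Defs.v *)
From HB Require Import structures.
From mathcomp Require Import all_boot all_order all_algebra.
From mathcomp Require Import all_classical all_reals all_analysis.

Set Implicit Arguments.
Unset Strict Implicit.
Unset Printing Implicit Defensive.

Import Order.TTheory GRing.Theory Num.Theory.
Import numFieldNormedType.Exports.

Local Open Scope classical_set_scope.
Local Open Scope ring_scope.

(* The scalar field K is generic here; it is meant to be instantiated with the
   reals or the complex numbers R[i]. Norms take their values in K. For K = R[i]
   the order is the partial one for which x <= y says that y - x is a nonnegative
   real, so "0 < e" already says that e is a positive real. *)

Definition closed_convex_hull (K : numFieldType) (X : normedModType K)
    (A : set X) : set X :=
  smallest (fun C : set X => closed C /\ convex_set (C : set (convex_lmodType X)))
           A.

Definition dentable (K : numFieldType) (X : normedModType K) (A : set X) : Prop :=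
  forall delta : K, 0 < delta ->
    exists2 a, A a
      & ~ closed_convex_hull (A `\` [set b | `|b - a| < delta]) a.

Definition radon_nikodym_property (K : numFieldType) (X : normedModType K) : Prop :=
  forall A : set X, A !=set0 -> bounded_set A -> dentable A.

Definition unit_ball (K : numFieldType) (X : normedModType K) : set X :=
  [set x | `|x| <= 1].
Arguments unit_ball {K} X.

Record bounded_operator (K : numFieldType) (X Y : normedModType K) := BoundedOperator {
  bounded_operator_linear :> {linear X -> Y};
  bounded_operatorP : [bounded bounded_operator_linear x | x in unit_ball X]
}.

(* The least upper bound is taken in K itself. For K = R[i] it still is the usual
   supremum: every upper bound of a nonempty set of nonnegative reals is real. *)
Definition operator_norm (K : numFieldType) (X Y : normedModType K) (f : X -> Y) : K :=
  supremum 0 [set `|f x| | x in unit_ball X].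

Definition uniquely_quasi_norm_attaining (K : numFieldType) (X Y : normedModType K)
    (T : bounded_operator X Y) : Prop :=
  exists u : Y, forall x : nat -> X,
    (forall n, unit_ball X (x n)) ->
    `|T (x n)| @[n --> \oo] --> operator_norm T ->
    exists2 sigma : nat -> nat, increasing_seq sigma
      & exists2 theta : K, `|theta| = 1
          & T (x (sigma n)) @[n --> \oo] --> theta *: u.

(* Density for the topology of the metric (S, T) |-> operator_norm (S - T). *)
Definition dense_in_operator_norm (K : numFieldType) (X Y : normedModType K)
    (D : set (bounded_operator X Y)) : Prop :=
  forall (T : bounded_operator X Y) (e : K), 0 < e ->
    exists2 S, D S & operator_norm (S \- T) < e.

(* Main.v *)
(* Let Z be X or Y, whichever has the RNP, and factor T as B A through Z, with A or
   B the identity. Put D = A(B_X) and phi z = |B z|. A Stegall-type variational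
   principle gives a small real-linear f such that phi + f strongly exposes some
   u0 on D. With F the K-linear functional of real part f, the operator
   S = T + F(A .) B u0 / |B u0| has norm phi u0 + f u0 because D is balanced, and
   |S x_n| -> |S| forces theta_n A x_n -> u0 with |theta_n| = 1; a convergent
   subsequence of theta_n finishes the proof (if B u0 = 0, then T is small and
   S = 0 will do).

   For the variational principle, if every small perturbation of phi had only
   slices of diameter at least delta, Hahn-Banach separation would show that
   each point of a slice is almost a convex combination of points, at distance
   at least delta / 2, of slices of further perturbations. Iterating yields an
   approximate bush, whose limits of averages form a bounded non-dentable set.
   So small slices can be reached; summing up ever smaller perturbations gives f. *)
From HB Require Import structures.
Require Import Defs.
From mathcomp Require Import all_boot all_order all_algebra.
From mathcomp Require Import all_classical all_reals all_analysis.
From mathcomp Require Import complex.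
From mathcomp Require Import ring lra.

Set Implicit Arguments.
Unset Strict Implicit.
Unset Printing Implicit Defensive.

Import Order.TTheory GRing.Theory Num.Theory.
Import numFieldNormedType.Exports.

Local Open Scope classical_set_scope.
Local Open Scope ring_scope.

(** * Hahn-Banach separation *)

Lemma scalar0 (K : pzRingType) (V : lmodType K) (f : V -> K) : scalar f -> f 0 = 0.
Proof. by move=> lf; have := lf (-1) 0 0; rewrite scaler0 addr0 mulN1r addNr. Qed.

Lemma le_infD (R : realType) (A B : set R) (x : R) : A !=set0 -> B !=set0 ->
  (forall a b, A a -> B b -> x <= a + b) -> x <= inf A + inf B.
Proof.
move=> A0 B0 xAB; rewrite -lerBlDr; apply: lb_le_inf => // a Aa.
rewrite lerBlDr -lerBlDl; apply: lb_le_inf => // b Bb.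
by rewrite lerBlDl xAB.
Qed.

Section HahnBanach.
Variables (R : realType) (V : lmodType R).
Implicit Types (p q f : V -> R) (Q : set V) (u v : V).

Definition sublinear p :=
  (forall u v, p (u + v) <= p u + p v) /\
  (forall t u, 0 <= t -> p (t *: u) <= t * p u).

Definition real_convex Q := forall u v t, 0 <= t <= 1 -> Q u -> Q v ->
  Q (t *: u + (1 - t) *: v).

Lemma sublinear0 p : sublinear p -> p 0 = 0.
Proof.
case=> pD pZ; apply/eqP; rewrite eq_le; apply/andP; split.
  by have := pZ 0 0 (lexx _); rewrite scale0r mul0r.
by have := pD 0 0; rewrite addr0; lra.
Qed.

Lemma sublinearZ p t u : sublinear p -> 0 <= t -> p (t *: u) = t * p u.
Proof.
move=> sp; have [pD pZ] := sp.
rewrite le_eqVlt => /orP[/eqP<-|t0].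
  by rewrite scale0r sublinear0 // mul0r.
apply/eqP; rewrite eq_le (pZ _ _ (ltW t0)) /=.
rewrite -ler_pdivlMl //; have := pZ t^-1 (t *: u).
by rewrite scalerA mulVf ?gt_eqF // scale1r invr_ge0; apply; exact: ltW.
Qed.

Lemma sublinearN p u : sublinear p -> - p (- u) <= p u.
Proof.
move=> sp; have [pD _] := sp; have := pD u (- u).
by rewrite subrr sublinear0 //; lra.
Qed.

(* Dominated by [p], and linear functionals below it are at least [c] on [Q]; with
   [Q = {v}] and [c = p v] it shows that minimal sublinear functionals are
   additive. *)
Definition push p Q (c : R) u : R :=
  inf [set p (u + tv.1 *: tv.2) - tv.1 * c | tv in [set tv | 0 <= tv.1 /\ Q tv.2]].

Section Push.
Variables (p : V -> R) (Q : set V) (c : R).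
Hypotheses (sp : sublinear p) (Q0 : Q !=set0) (cQ : real_convex Q).
Hypothesis pQ : forall v, Q v -> c <= p v.

Let E u := [set p (u + tv.1 *: tv.2) - tv.1 * c | tv in [set tv | 0 <= tv.1 /\ Q tv.2]].

Let E0 u : E u !=set0.
Proof. by case: Q0 => v Qv; exists (p (u + 0 *: v) - 0 * c), (0, v). Qed.

Let lbE u : lbound (E u) (- p (- u)).
Proof.
move=> _ [[t v] /= [t0 Qv] <-].
have := sp.1 (u + t *: v) (- u); rewrite addrAC subrr add0r.
rewrite (sublinearZ _ sp t0) => H.
have := ler_wpM2l t0 (pQ Qv); lra.
Qed.

Lemma push_le u t v : 0 <= t -> Q v -> push p Q c u <= p (u + t *: v) - t * c.
Proof.
by move=> t0 Qv; apply: ge_inf; [exists (- p (- u)); exact: lbE | exists (t, v)].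
Qed.

Lemma push_le_id u : push p Q c u <= p u.
Proof.
case: Q0 => v Qv; have := push_le u (lexx 0) Qv.
by rewrite scale0r addr0 mul0r subr0.
Qed.

(** For subadditivity, convexity of [Q] merges the pairs [(t, x)] and [(s, y)] into one pair with
    weight [t + s] and the weighted mean of [x] and [y]. *)
Lemma push_sublinear : sublinear (push p Q c).
Proof.
split=> [u v|t u].
  apply: le_infD => [||_ _ [[t x] /= [t0 Qx] <-] [[s y] /= [s0 Qy] <-]]; [exact: E0..|].
  have [ts0|ts0] := eqVneq (t + s) 0.
    have [-> ->] : t = 0 /\ s = 0 by split; lra.
    apply: le_trans (push_le_id _) _.
    by rewrite !scale0r !addr0 !mul0r !subr0 sp.1.
  have tsp : 0 < t + s by rewrite lt_neqAle eq_sym ts0 addr_ge0.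
  have Qz : Q ((t / (t + s)) *: x + (1 - t / (t + s)) *: y).
    by apply: cQ => //; rewrite divr_ge0 ?(ltW tsp) //= ler_pdivrMr // mul1r; lra.
  apply: le_trans (push_le (u + v) (ltW tsp) Qz) _.
  rewrite scalerDr !scalerA mulrCA divff // mulr1 mulrBr mulr1 mulrCA divff // mulr1.
  have -> : t + s - t = s by ring.
  have := sp.1 (u + t *: x) (v + s *: y).
  by rewrite (addrACA u) ; lra.
rewrite le_eqVlt => /orP[/eqP<-|t0].
  rewrite scale0r mul0r; apply: le_trans (push_le_id _) _.
  by rewrite sublinear0.
rewrite -ler_pdivrMl //; apply: lb_le_inf => [|_ [[s x] /= [s0 Qx] <-]]; first exact: E0.
rewrite ler_pdivrMl //; apply: le_trans (push_le (t *: u) (mulr_ge0 (ltW t0) s0) Qx) _.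
rewrite -scalerA -scalerDr (sublinearZ _ sp (ltW t0)); lra.
Qed.

End Push.

Lemma minimal_sublinear_additive p : sublinear p ->
  (forall q, sublinear q -> (forall v, q v <= p v) -> forall v, q v = p v) ->
  forall u v, p (u + v) = p u + p v.
Proof.
move=> sp pmin u v; apply/eqP; rewrite eq_le sp.1 /=.
pose Q := [set v]; have Q0 : Q !=set0 by exists v.
have cQ : real_convex Q.
  by move=> _ _ t _ -> ->; rewrite /Q /= -scalerDl addrC subrK scale1r.
have pQ w : Q w -> p v <= p w by move=> ->.
have sq := push_sublinear sp Q0 cQ pQ.
(* By minimality the pushed functional is [p] itself; weight 1 at [v] then gives
   [p u <= p (u + v) - p v]. *)
have := pmin _ sq (push_le_id sp Q0 pQ) u.
have := push_le sp pQ u ler01 (erefl v : Q v).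
by rewrite scale1r mul1r => ? <-; lra.
Qed.

(** Zorn's lemma for the reversed pointwise order: a chain is bounded by its pointwise infimum,
    which is finite because a sublinear [q <= p] satisfies [- p (- v) <= q v]. *)
Lemma exists_minimal_sublinear p : sublinear p -> exists q,
  [/\ sublinear q, forall v, q v <= p v & forall r, sublinear r ->
    (forall v, r v <= q v) -> forall v, r v = q v].
Proof.
move=> sp; pose T := {q : V -> R | sublinear q /\ forall v, q v <= p v}.
pose Rel (q r : T) := `[< forall v, sval r v <= sval q v >].
have [||||[q [sq qp]] qmin] := @Zorn T Rel.
- by move=> q; apply/asboolP.
- move=> q r s /asboolP qr /asboolP rs; apply/asboolP => v.
  exact: le_trans (rs v) (qr v).
- move=> [q hq] [r hr] /asboolP /= qr /asboolP /= rq; apply: eq_exist => /=.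
  by apply/funext => v; apply/eqP; rewrite eq_le qr rq.
- move=> A totA; have [[q0 Aq0]|A0] := pselect (A !=set0); last first.
    exists (exist _ p (conj sp (fun=> lexx _))) => s As.
    by case: A0; exists s.
  pose E v := [set sval q v | q in A].
  have E0 v : E v !=set0 by exists (sval q0 v), q0.
  have lbE v : lbound (E v) (- p (- v)).
    move=> _ [[q [sq qp]] _ <-] /=.
    by apply: le_trans (sublinearN _ sq); rewrite lerN2.
  have infE v (q : T) : A q -> inf (E v) <= sval q v.
    by move=> Aq; apply: ge_inf; [exists (- p (- v)) | exists q].
  have hs : sublinear (fun v => inf (E v)) /\ forall v, inf (E v) <= p v.
    split; last first.
      move=> v; apply: le_trans (infE v _ Aq0) _; exact: (svalP q0).2.
    split=> [u v|t u t0].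
      apply: le_infD => // _ _ [q Aq <-] [r Ar <-].
      have [/asboolP qr|/asboolP rq] := totA _ _ Aq Ar.
        apply: le_trans (infE _ _ Ar) _; apply: le_trans ((svalP r).1.1 _ _) _.
        by rewrite lerD2r.
      apply: le_trans (infE _ _ Aq) _; apply: le_trans ((svalP q).1.1 _ _) _.
      by rewrite lerD2l.
    move: t0; rewrite le_eqVlt => /orP[/eqP<-|t0].
      rewrite scale0r mul0r; apply: le_trans (infE _ _ Aq0) _.
      by rewrite sublinear0 //; exact: (svalP q0).1.
    rewrite -ler_pdivrMl //; apply: lb_le_inf => // _ [q Aq <-].
    rewrite ler_pdivrMl //; apply: le_trans (infE _ _ Aq) _.
    by apply: (svalP q).1.2; exact: ltW.
  pose m : T := exist _ (fun v => inf (E v)) hs.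
  exists m => s As; apply/asboolP => v /=; exact: infE.
exists q; split=> // r sr rq v.
have rp w : r w <= p w by exact: le_trans (rq w) (qp w).
have := qmin (exist _ r (conj sr rp)) => /(_ _)/(congr1 sval) /= -> //.
exact/asboolP.
Qed.

Theorem Hahn_Banach_sublinear p : sublinear p ->
  exists2 f : V -> R, scalar f & forall v, f v <= p v.
Proof.
move=> /exists_minimal_sublinear[f [sf fp fmin]]; exists f => // a u v.
have fD := minimal_sublinear_additive sf fmin.
have fN w : f (- w) = - f w.
  by apply/eqP; rewrite -addr_eq0 -fD addNr sublinear0.
rewrite fD; congr (_ + _).
have [a0|/ltW a0] := leP 0 a; first by rewrite sublinearZ.
by rewrite -[a in LHS]opprK scaleNr fN sublinearZ ?oppr_ge0 // mulNr opprK.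
Qed.

(** A linear functional below [push p Q c] works: at [- v], with weight 1, the bound reads
    [f (- v) <= p 0 - c]. *)
Theorem Hahn_Banach_separation p Q (c : R) : sublinear p -> Q !=set0 ->
  real_convex Q -> (forall v, Q v -> c <= p v) ->
  exists f : V -> R, [/\ scalar f, forall v, f v <= p v & forall v, Q v -> c <= f v].
Proof.
move=> sp Q0 cQ pQ.
have [f lf fp] := Hahn_Banach_sublinear (push_sublinear sp Q0 cQ pQ).
exists f; split=> // [v|v Qv]; first exact: le_trans (fp v) (push_le_id sp Q0 pQ v).
have := le_trans (fp (- v)) (push_le sp pQ (- v) ler01 Qv).
rewrite scale1r addNr sublinear0 // mul1r -[- v]addr0 -scaleN1r lf.
by rewrite (scalar0 lf); lra.
Qed.

End HahnBanach.

(** * Small slices in dentable spaces *)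

Lemma increasing_seq_ge_id (sigma : nat -> nat) :
  increasing_seq sigma -> forall n, (n <= sigma n)%N.
Proof.
move=> si; elim=> // n IHn; apply: leq_ltn_trans IHn _.
by rewrite ltnNge; have := si n.+1 n; rewrite leEnat ltnn => ->.
Qed.

Lemma exists_div_pow2_le (R : realType) (x r : R) : 0 <= x -> 0 < r ->
  exists m, x / 2 ^+ m <= r.
Proof.
move=> x0 r0; have xr0 : 0 <= x / r by rewrite divr_ge0 // ltW.
exists (Num.bound (x / r)); rewrite ler_pdivrMr ?exprn_gt0 // mulrC -ler_pdivrMr //.
apply: le_trans (ltW (archi_boundP xr0)) _.
by rewrite -natrX ler_nat ltnW // ltn_expl.
Qed.

(** The intervals of centre [x n] and radius [2 * c n] are nested, so the infimum of their right
    ends lies in all of them. *)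
Lemma real_geometric_limit (R : realType) (x c : nat -> R) :
  (forall n, `|x n.+1 - x n| <= c n) -> (forall n, c n.+1 <= c n / 2) ->
  exists l, forall n, `|x n - l| <= 2 * c n.
Proof.
move=> xc cc; have c0 n : 0 <= c n by apply: le_trans (xc n).
pose u n := x n + 2 * c n; pose v n := x n - 2 * c n.
have xcn n : x n - c n <= x n.+1 <= x n + c n.
  by have := xc n; rewrite ler_distl.
have uS : {homo u : n m / (n <= m)%N >-> n >= m}.
  by apply/nonincreasing_seqP => n; rewrite /u; have := xcn n; have := cc n; lra.
have vS : {homo v : n m / (n <= m)%N >-> n <= m}.
  by apply/nondecreasing_seqP => n; rewrite /v; have := xcn n; have := cc n; lra.
have vu m n : v m <= u n.
  apply: le_trans (vS m (maxn m n) (leq_maxl m n)) _.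
  apply: (le_trans _ (uS n (maxn m n) (leq_maxr m n))).
  by rewrite /u /v; have := c0 (maxn m n); lra.
have lbu m : lbound (range u) (v m) by move=> _ [n _ <-].
exists (inf (range u)) => n; rewrite distrC ler_distl; apply/andP; split.
  by apply: lb_le_inf; [exists (u 0%N), 0%N | exact: lbu n].
by apply: ge_inf; [exists (v 0%N) | exists n].
Qed.

(** * Finite convex combinations *)

Section ConvexTrees.
Variables (R : realType) (V : lmodType R).
Implicit Types (P : set V) (f g : V -> V) (N : V -> R).

(** The weight at a node goes to its left subtree. In this encoding points are replaced leaf by leaf
    with the weights untouched, which suits iterated averaging. *)
Inductive convex_tree := Leaf of V | Node of R & convex_tree & convex_tree.

Fixpoint leaves_in P (s : convex_tree) : Prop :=
  match s with
  | Leaf v => P v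
  | Node t l r => [/\ 0 <= t <= 1, leaves_in P l & leaves_in P r]
  end.

Fixpoint barycenter f (s : convex_tree) : V :=
  match s with
  | Leaf v => f v
  | Node t l r => t *: barycenter f l + (1 - t) *: barycenter f r
  end.

Fixpoint map_leaves f (s : convex_tree) : convex_tree :=
  match s with
  | Leaf v => Leaf (f v)
  | Node t l r => Node t (map_leaves f l) (map_leaves f r)
  end.

Definition is_norm N :=
  [/\ forall u v, N (u + v) <= N u + N v, forall t u, N (t *: u) = `|t| * N u
    & forall u, N u = 0 -> u = 0].

Lemma barycenter_map f s : barycenter id (map_leaves f s) = barycenter f s.
Proof. by elim: s => //= t l -> r ->. Qed.

Lemma leaves_in_map P P' f s : (forall v, P v -> P' (f v)) ->
  leaves_in P s -> leaves_in P' (map_leaves f s).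
Proof.
move=> PP'; elim: s => [v|t l IHl r IHr] /=; first exact: PP'.
by case=> t01 /IHl ? /IHr ?; split.
Qed.

Lemma barycenter_dist P N f g (c : R) s : is_norm N -> leaves_in P s ->
  (forall v, P v -> N (f v - g v) <= c) ->
  N (barycenter f s - barycenter g s) <= c.
Proof.
case=> ND NZ _ + fg; elim: s => [v|t l IHl r IHr] /=; first exact: fg.
case=> /andP[t0 t1] /IHl Hl /IHr Hr.
have -> : t *: barycenter f l + (1 - t) *: barycenter f r -
    (t *: barycenter g l + (1 - t) *: barycenter g r) =
    t *: (barycenter f l - barycenter g l) +
    (1 - t) *: (barycenter f r - barycenter g r).
  by rewrite opprD addrACA -!scalerBr.
apply: le_trans (ND _ _) _; rewrite !NZ !ger0_norm ?subr_ge0 //.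
have := ler_wpM2l t0 Hl.
have : (1 - t) * N (barycenter f r - barycenter g r) <= (1 - t) * c.
  by apply: ler_wpM2l; rewrite ?subr_ge0.
lra.
Qed.

Lemma barycenters_convex P :
  real_convex [set v | exists2 s, leaves_in P s & barycenter id s = v].
Proof.
by move=> _ _ t t01 [s Ps <-] [r Pr <-]; exists (Node t s r).
Qed.

End ConvexTrees.
Arguments Leaf {R V}.

(** * Variational principle on an abstract real normed space *)

Section Variational.
Variables (R : realType) (V : lmodType R) (N : V -> R).
Implicit Types (f : V -> R) (u v z : V).

(** Dentability with the plain convex hull in place of the closed one: a weaker property, which the
    exact convex combinations of the bush already contradict. *)
Definition tree_dentable := forall A : set V, A !=set0 ->
  (exists M, forall a, A a -> N a <= M) -> forall delta, 0 < delta ->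
  exists2 a, A a & forall s,
    leaves_in (fun b => A b /\ delta <= N (b - a)) s -> barycenter id s <> a.

(** Completeness in terms of [N] alone, as [V] carries no topology; the factor 2 is the sum of the
    geometric series. *)
Definition geometrically_complete := forall (x : nat -> V) (c : nat -> R),
  (forall n, N (x n.+1 - x n) <= c n) -> (forall n, c n.+1 <= c n / 2) ->
  exists l, forall n, N (x n - l) <= 2 * c n.

Hypotheses (normN : is_norm N) (dentN : tree_dentable)
  (complN : geometrically_complete).

Lemma norm0 : N 0 = 0.
Proof. by case: normN => _ NZ _; rewrite -(scale0r 0) NZ normr0 mul0r. Qed.

Lemma normN_opp u : N (- u) = N u.
Proof. by case: normN => _ NZ _; rewrite -scaleN1r NZ normrN1 mul1r. Qed.

Lemma norm_dist u v : N (u - v) = N (v - u).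
Proof. by rewrite -normN_opp opprB. Qed.

Lemma norm_ge0 u : 0 <= N u.
Proof.
by have [ND _ _] := normN; have := ND u (- u); rewrite subrr norm0 normN_opp; lra.
Qed.

Lemma norm_triangle v u w : N (u - w) <= N (u - v) + N (v - w).
Proof. by have [ND _ _] := normN; have := ND (u - v) (v - w); rewrite subrKA. Qed.

Lemma norm_sublinear : sublinear N.
Proof. by have [ND NZ _] := normN; split=> // t u t0; rewrite NZ ger0_norm. Qed.

Variables (D : set V) (phi : V -> R) (M : R).
Hypotheses (D0 : D !=set0) (DM : forall v, D v -> N v <= M)
  (phiM : forall v, D v -> phi v <= M).

(** The slice of [D] of depth [alpha] cut off by [phi + f], written without the supremum. *)
Definition almost_maximizers f (alpha : R) :=
  [set z | D z /\ forall z', D z' -> phi z' + f z' <= phi z + f z + alpha].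

Lemma almost_maximizers_nonempty f c alpha : (forall v, `|f v| <= c * N v) ->
  0 <= c -> 0 < alpha -> almost_maximizers f alpha !=set0.
Proof.
move=> fN c0 a0; pose E := [set phi z + f z | z in D].
have E0 : E !=set0 by case: D0 => z Dz; exists (phi z + f z), z.
have ubE : has_ubound E.
  exists (M + c * M) => _ [z Dz <-]; apply: lerD; first exact: phiM.
  apply: le_trans (ler_norm _) _; apply: le_trans (fN z) _.
  by apply: ler_wpM2l => //; exact: DM.
have [_ [z Dz <-] hz] := sup_adherent a0 (conj E0 ubE).
exists z; split=> // z' Dz'.
have : phi z' + f z' <= sup E by apply: sup_upper_bound => //; exists z'.
lra.
Qed.

(** * An approximate bush from fat slices *)

Section Bush.
Variables (f0 : V -> R) (eps delta : R).
Hypotheses (lf0 : scalar f0) (eps0 : 0 < eps) (delta0 : 0 < delta).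
Variable c0 : R.
Hypotheses (c00 : 0 <= c0) (f0N : forall v, `|f0 v| <= c0 * N v).
(** To be refuted: no slice given by a functional [eps]-close to [f0] fits in an open ball of radius
    [delta]. *)
Hypothesis fat : forall f alpha, scalar f ->
  (forall v, `|f v - f0 v| <= eps * N v) -> 0 < alpha -> forall z0,
  exists2 z, almost_maximizers f alpha z & delta <= N (z - z0).

(** At generation [n], [gam n] bounds the averaging error, [tau n] is the size of the perturbation
    and [alp n] the depth of the slice. The errors sum to [delta / 4], the perturbations to
    [eps]. *)
Let gam n := delta / 8 / 2 ^+ n.
Let tau n := eps / 2 / 2 ^+ n.
Let alp n := gam n * tau n / 4.

Let gam_gt0 n : 0 < gam n. Proof. by rewrite !divr_gt0 // exprn_gt0. Qed.
Let tau_gt0 n : 0 < tau n. Proof. by rewrite !divr_gt0 // exprn_gt0. Qed.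
Let alp_gt0 n : 0 < alp n. Proof. by rewrite divr_gt0 // mulr_gt0. Qed.
Let gamS n : gam n.+1 = gam n / 2.
Proof. by rewrite /gam exprS invfM; lra. Qed.
Let tauS n : tau n.+1 = tau n / 2.
Proof. by rewrite /tau exprS invfM; lra. Qed.
Let gam_le0 n : gam n <= gam 0%N.
Proof. by elim: n => // n; rewrite gamS; have := gam_gt0 n; lra. Qed.

(** The bound [eps - 2 * tau n] is the sum of the [tau k] for [k < n]; it vanishes at [n = 0], where
    only [f0] is allowed. *)
Let C n := [set z | exists f, [/\ scalar f,
  forall v, `|f v - f0 v| <= (eps - 2 * tau n) * N v & almost_maximizers f (alp n) z]].

(* If no such tree existed, a functional separating [z] from the far points of
   [C n.+1], added to [f] with weight [tau n], would make a slice avoid the far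
   points, against [fat]. *)
Lemma branch n z : C n z -> exists2 s,
  leaves_in (fun z' => C n.+1 z' /\ delta <= N (z' - z)) s &
  N (barycenter id s - z) < gam n.
Proof.
move=> [f [lf ff0 [Dz fz]]].
pose P z' := C n.+1 z' /\ delta <= N (z' - z).
(* The functional becomes [f - tau n * w], and [fat] gives a far point [z'] of its slice. The two
   slice inequalities add up to [tau n * w (z' - z) <= alp n + alp n.+1], which is below
   [tau n * gam n]. *)
have step w : scalar w -> (forall v, w v <= N v) -> exists2 z', P z' &
    w (z' - z) < gam n.
  move=> lw wN; pose g v := f v - tau n * w v.
  have lg : scalar g by move=> a u v; rewrite /g lf lw; ring.
  have wN' v : `|w v| <= N v.
    rewrite ler_norml wN andbT lerNl -normN_opp; apply: le_trans (wN _).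
    by rewrite -[- v]addr0 -scaleN1r lw (scalar0 lw); lra.
  have gf0 v : `|g v - f0 v| <= (eps - 2 * tau n.+1) * N v.
    have -> : g v - f0 v = (f v - f0 v) - tau n * w v by rewrite /g; ring.
    apply: le_trans (ler_normB _ _) _; rewrite normrM (gtr0_norm (tau_gt0 n)).
    have := ler_wpM2l (ltW (tau_gt0 n)) (wN' v).
    by have := ff0 v; rewrite tauS; lra.
  have gf0' v : `|g v - f0 v| <= eps * N v.
    apply: le_trans (gf0 v) _; apply: ler_wpM2r; first exact: norm_ge0.
    by have := tau_gt0 n.+1; lra.
  have [z' [Dz' gz'] dz'] := fat lg gf0' (alp_gt0 n.+1) z.
  exists z'; first by split=> //; exists g.
  have wB : w (z' - z) = w z' - w z.
    by rewrite [z' - z]addrC -scaleN1r lw; ring.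
  have := fz _ Dz'; have := gz' _ Dz; rewrite wB /g => H1 H2.
  rewrite -(ltr_pM2l (tau_gt0 n)).
  have : alp n = gam n * tau n / 4 by [].
  have : alp n.+1 = alp n / 4 by rewrite /alp gamS tauS; field.
  have : 0 < gam n * tau n by rewrite mulr_gt0.
  lra.
apply: contrapT => nos.
(* Convex combinations of far points, translated by [- z]; without the desired tree the norm is at
   least [gam n] on this convex set. *)
pose Q := [set v | exists2 s, leaves_in P s & barycenter id s = v + z].
have Q0 : Q !=set0.
  have [//||z' Pz' _] := step (fun=> 0); last by exists (z' - z), (Leaf z'); rewrite /= ?subrK.
  - by move=> a u v; rewrite mulr0 addr0.
  - by move=> v; exact: norm_ge0.
have cQ : real_convex Q.
  move=> u v t t01 Qu Qv; have := barycenters_convex t01 Qu Qv.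
  by rewrite /Q /= !scalerDr addrACA -scalerDl [t + _]addrC subrK scale1r.
have QN v : Q v -> gam n <= N v.
  move=> [s Ps sv]; rewrite leNgt; apply/negP => vg; apply: nos; exists s => //.
  by rewrite sv addrK.
have [w [lw wN wQ]] := Hahn_Banach_separation norm_sublinear Q0 cQ QN.
have [z' Pz'] := step w lw wN; rewrite ltNge => /negP; apply; apply: wQ.
by exists (Leaf z') => //=; rewrite subrK.
Qed.

Lemma fat_slices_absurd : False.
Proof.
have /choice[tree treeP] : forall nz, exists s, C nz.1 nz.2 ->
    leaves_in (fun z' => C nz.1.+1 z' /\ delta <= N (z' - nz.2)) s /\
    N (barycenter id s - nz.2) < gam nz.1.
  move=> [n z] /=; have [/branch[s sC sz]|nC] := pselect (C n z).
    by exists s.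
  by exists (Leaf 0).
(* [e m n z] averages [m] generations of descendants of [z]; in the limit each
   point is exactly a convex combination of its children. *)
pose fix e m n z {struct m} := if m is m'.+1 then barycenter (e m' n.+1) (tree (n, z)) else z.
have eS m n z : C n z -> N (e m.+1 n z - e m n z) <= gam (n + m)%N.
  elim: m n z => [|m IHm] n z Cz.
    by rewrite addn0 /=; have [_ /ltW] := treeP (n, z) Cz.
  have [lv _] := treeP (n, z) Cz.
  apply: (barycenter_dist normN lv) => z' [Cz' _].
  by rewrite addnS -addSn; exact: IHm.
have /choice[lim limP] : forall nz, exists l, C nz.1 nz.2 -> forall m,
    N (e m nz.1 nz.2 - l) <= 2 * gam (nz.1 + m)%N.
  move=> [n z] /=; have [Cz|nC] := pselect (C n z); last by exists 0.
  have [||l hl] := @complN (fun m => e m n z) (fun m => gam (n + m)%N).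
  - by move=> m; exact: eS.
  - by move=> m; rewrite addnS gamS.
  by exists l.
(* Both sides are limits of [e m.+1 n z]: averaging over a fixed tree does not increase errors, so
   the limits at the children may be averaged. *)
have limE n z : C n z ->
    lim (n, z) = barycenter (fun z' => lim (n.+1, z')) (tree (n, z)).
  move=> Cz; apply/eqP; rewrite -subr_eq0; apply/eqP.
  have [_ _ N0] := normN; apply: N0; apply/eqP; rewrite eq_le norm_ge0 andbT.
  apply/ler_addgt0Pr => r r0; rewrite add0r.
  have [m hm] : exists m, delta / 8 / 2 ^+ m <= r / 4.
    by apply: exists_div_pow2_le; rewrite ?ltW ?divr_gt0.
  have {}hm : gam (n + m.+1)%N <= r / 4.
    apply: (le_trans _ hm); rewrite /gam ler_pM2l ?divr_gt0 //.
    by rewrite lef_pV2 ?posrE ?exprn_gt0 // ler_eXn2l ?ltr1n // addnS -addSn leq_addl.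
  apply: le_trans (norm_triangle (e m.+1 n z) _ _) _.
  have [lv _] := treeP (n, z) Cz.
  have H : N (e m.+1 n z - barycenter (fun z' => lim (n.+1, z')) (tree (n, z))) <=
      2 * gam (n + m.+1)%N.
    apply: (barycenter_dist normN lv) => z' [Cz' _].
    by rewrite addnS -addSn; exact: (limP (n.+1, z') Cz').
  by have := limP (n, z) Cz m.+1; rewrite /= norm_dist; lra.
have lim_dist n z : C n z -> N (z - lim (n, z)) <= delta / 4.
  move=> Cz; have := limP (n, z) Cz 0%N; rewrite addn0 /= => H.
  apply: le_trans H _; have := gam_le0 n; rewrite [in leRHS]/gam expr0; lra.
pose A := [set v | exists nz, C nz.1 nz.2 /\ lim nz = v].
have AE n z : C n z -> A (lim (n, z)) by exists (n, z).
(* Passing to limits moves a point and each of its children by at most [delta / 4], so their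
   distance stays at least [delta / 2]. *)
have [||a [[n z] [/= Cz <-]] nodent] := @dentN A _ _ _ (divr_gt0 delta0 (ltr0n _ 2)).
- have [z mz] := almost_maximizers_nonempty f0N c00 (alp_gt0 0).
  exists (lim (0%N, z)); apply: AE; exists f0; split=> // v.
  by rewrite subrr normr0 /tau expr0; have := norm_ge0 v; lra.
- exists (M + delta / 4) => _ [[n z] [/= Cz <-]].
  have := norm_triangle z (lim (n, z)) 0; rewrite !subr0 norm_dist.
  by have := lim_dist _ _ Cz; have [g [_ _ [/DM Nz _]]] := Cz; lra.
have [lv _] := treeP (n, z) Cz.
apply: (nodent (map_leaves (fun z' => lim (n.+1, z')) (tree (n, z)))).
  apply: leaves_in_map lv => z' /= [Cz' dz']; split; first exact: AE.
  have := norm_triangle (lim (n.+1, z')) z' z.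
  have := norm_triangle (lim (n, z)) (lim (n.+1, z')) z.
  have := lim_dist _ _ Cz; have := lim_dist _ _ Cz'.
  by rewrite (norm_dist (lim (n, z))); lra.
by rewrite barycenter_map -limE.
Qed.

End Bush.

(** If every slice had larger diameter, none would fit in an open ball of radius [delta / 2], and
    [fat_slices_absurd] refutes this. *)
Lemma small_slice f0 c0 eps delta : scalar f0 ->
  0 <= c0 -> (forall v, `|f0 v| <= c0 * N v) -> 0 < eps -> 0 < delta ->
  exists f alpha, [/\ scalar f, forall v, `|f v - f0 v| <= eps * N v, 0 < alpha &
    forall z z', almost_maximizers f alpha z -> almost_maximizers f alpha z' ->
      N (z - z') <= delta].
Proof.
move=> lf0 c00 f0N eps0 delta0; apply: contrapT => nof.
have delta20 : 0 < delta / 2 by rewrite divr_gt0.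
apply: (fat_slices_absurd lf0 eps0 delta20 c00 f0N) => f alpha lf ff0 a0 z0.
apply: contrapT => noz; apply: nof; exists f, alpha; split=> // z z' fz fz'.
have near y : almost_maximizers f alpha y -> N (y - z0) < delta / 2.
  by move=> fy; rewrite ltNge; apply/negP => ?; apply: noz; exists y.
have := norm_triangle z0 z z'; rewrite (norm_dist z0).
by have := near _ fz; have := near _ fz'; lra.
Qed.

(** Iterates [small_slice] with rapidly shrinking steps; on [D] the limit functional stays so close
    to each approximant that its thin slices lie inside theirs. *)
Theorem strongly_exposing_perturbation eps : 0 < eps -> exists f,
  [/\ scalar f, forall v, `|f v| <= eps * N v & forall delta, 0 < delta ->
   exists2 alpha, 0 < alpha &
    forall z z', almost_maximizers f alpha z -> almost_maximizers f alpha z' ->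
      N (z - z') <= delta].
Proof.
move=> eps0; pose M1 := `|M| + 1.
have M10 : 0 < M1 by rewrite ltr_wpDl.
have DM1 v : D v -> N v <= M1.
  by move=> /DM NM; rewrite /M1; have := ler_norm M; lra.
pose good (s : (V -> R) * R) :=
  [/\ scalar s.1, 0 < s.2 & exists2 c, 0 <= c & forall v, `|s.1 v| <= c * N v].
(* Here [s.2] is at once the depth of the current slice, the allowed diameter of the next one and,
   divided by [8 * M1], the size of the next perturbation. *)
pose next (s s' : (V -> R) * R) := good s -> [/\ good s',
  forall v, `|s'.1 v - s.1 v| <= s.2 / (8 * M1) * N v, s'.2 <= s.2 / 2 &
  forall z z', almost_maximizers s'.1 s'.2 z -> almost_maximizers s'.1 s'.2 z' ->
    N (z - z') <= s.2].
have nextP s : {s' | next s s'}.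
  apply: cid; have [[l0 e0 [c c0 fc]]|ng] := pselect (good s); last by exists s.
  have k0 : 0 < s.2 / (8 * M1) by rewrite divr_gt0 // mulr_gt0.
  have [f [a [lf ff a0 fa]]] := small_slice l0 c0 fc k0 e0.
  (* Halving makes the perturbations summable; the minimum keeps the slice inside the one of depth
     [a]. *)
  exists (f, Num.min a (s.2 / 2)) => _; split=> //=; last first.
  - move=> z z' [Dz fz] [Dz' fz']; apply: fa; split=> // y Dy.
      by apply: le_trans (fz _ Dy) _; rewrite lerD2l ge_min lexx.
    by apply: le_trans (fz' _ Dy) _; rewrite lerD2l ge_min lexx.
  - by rewrite ge_min lexx orbT.
  split=> //=; first by rewrite lt_min a0 divr_gt0.
  exists (s.2 / (8 * M1) + c); first by rewrite addr_ge0 // ltW.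
  move=> v; rewrite mulrDl -[f v](subrK (s.1 v)).
  by apply: le_trans (ler_normD _ _) _; apply: lerD.
(* This depth makes the bound [(s 0%N).2 / (4 * M1)] on the total perturbation equal to [eps]. *)
pose s0 : (V -> R) * R := (fun=> 0, eps * (4 * M1)).
have [s [s00 sS]] := dependent_choice nextP s0.
have sgood n : good (s n).
  elim: n => [|n /sS[] //]; rewrite s00; split=> /=.
  - by move=> a u v; rewrite mulr0 addr0.
  - by rewrite !mulr_gt0.
  - by exists 0 => // v; rewrite normr0 mul0r.
have /choice[f fP] : forall v, exists l, forall n,
    `|(s n).1 v - l| <= (s n).2 / (4 * M1) * N v.
  move=> v; have [||l hl] := @real_geometric_limit _ (fun n => (s n).1 v)
      (fun n => (s n).2 / (8 * M1) * N v).
  - by move=> n; have [_ ->] := sS n (sgood n).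
  - move=> n; rewrite [leRHS]mulrAC; apply: ler_wpM2r; first exact: norm_ge0.
    rewrite [leRHS]mulrAC; apply: ler_wpM2r; last by have [] := sS n (sgood n).
    by rewrite invr_ge0 mulr_ge0 // ltW.
  exists l => n; apply: le_trans (hl n) _; rewrite mulrA.
  by have -> : 2 * ((s n).2 / (8 * M1)) = (s n).2 / (4 * M1) by field; exact: lt0r_neq0.
have s_small r : 0 < r -> exists n, (s n).2 <= r.
  move=> r0; have [|n hn] := @exists_div_pow2_le _ (s 0%N).2 r _ r0.
    by have [_ /ltW] := sgood 0%N.
  exists n; apply: (le_trans _ hn) => {hn}; elim: n => [|n IHn]; first by rewrite expr0 divr1.
  have [_ _ h _] := sS n (sgood n); apply: le_trans h _.
  rewrite exprS invfM mulrCA [leRHS]mulrC; exact: ler_wpM2r.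
exists f; split.
- move=> a u v; apply/eqP; rewrite -subr_eq0 -normr_le0.
  pose Cst := (N (a *: u + v) + `|a| * N u + N v) / (4 * M1).
  have C0 : 0 <= Cst.
    by rewrite divr_ge0 ?addr_ge0 ?mulr_ge0 ?norm_ge0 ?(ltW M10).
  apply/ler_addgt0Pr => r r0; rewrite add0r.
  have [|n hn] := s_small (r / (Cst + 1)); first by rewrite divr_gt0 // ltr_wpDl.
  have [ln _ _] := sgood n.
  have -> : f (a *: u + v) - (a * f u + f v) =
     - ((s n).1 (a *: u + v) - f (a *: u + v)) + (a * ((s n).1 u - f u) +
       ((s n).1 v - f v)) by rewrite ln; ring.
  apply: le_trans (ler_normD _ _) _; rewrite normrN.
  apply: (@le_trans _ _ (Cst * (s n).2)).
    apply: le_trans (lerD (fP _ n) (ler_normD _ _)) _; rewrite normrM.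
    have := ler_wpM2l (normr_ge0 a) (fP u n); have := fP v n.
    rewrite /Cst; set i := (4 * M1)^-1; lra.
  apply: le_trans (ler_wpM2l C0 hn) _.
  rewrite mulrA ler_pdivrMr ?ltr_wpDl //; nra.
- move=> v; have := fP v 0%N; rewrite s00 /= sub0r normrN mulfK //.
  by rewrite lt0r_neq0 // mulr_gt0.
- move=> delta delta0; have [n hn] := s_small _ delta0.
  have [_ sn0 _] := sgood n.+1; exists ((s n.+1).2 / 2); first by rewrite divr_gt0.
  have [_ _ _ diam] := sS n (sgood n).
  have close z : D z -> `|(s n.+1).1 z - f z| <= (s n.+1).2 / 4.
    move=> Dz; apply: le_trans (fP z n.+1) _.
    apply: le_trans (ler_wpM2l _ (DM1 _ Dz)) _.
      by rewrite divr_ge0 ?mulr_ge0 ?(ltW M10) ?(ltW sn0).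
    by rewrite invfM mulrA mulfVK ?lt0r_neq0.
  (* Half of [(s n.+1).2] comes from the depth, and a quarter from the error at each of the two
     points. *)
  have sub z : almost_maximizers f ((s n.+1).2 / 2) z ->
      almost_maximizers (s n.+1).1 (s n.+1).2 z.
    move=> [Dz fz]; split=> // z' Dz'; have := fz _ Dz'.
    by have := close _ Dz; have := close _ Dz'; rewrite !ler_norml; lra.
  by move=> z z' /sub fz /sub fz'; apply: le_trans hn; exact: diam.
Qed.

Lemma almost_maximizersS f a b : a <= b ->
  almost_maximizers f a `<=` almost_maximizers f b.
Proof.
move=> ab z [Dz fz]; split=> // z' Dz'; apply: le_trans (fz _ Dz') _.
by rewrite lerD2l.
Qed.

(** The point [u0] is the limit of shrinking slices and may lie outside [D]; the Lipschitz bound on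
    [phi] carries maximality over to it. *)
Theorem strongly_exposed_point eps b : 0 < eps -> 0 <= b ->
  (forall u v, `|phi u - phi v| <= b * N (u - v)) ->
  exists f u0, [/\ scalar f, forall v, `|f v| <= eps * N v,
    forall z, D z -> phi z + f z <= phi u0 + f u0,
    forall delta, 0 < delta -> exists2 z, D z & N (z - u0) <= delta &
    forall delta, 0 < delta -> exists2 alpha, 0 < alpha & forall z, D z ->
      phi u0 + f u0 - alpha <= phi z + f z -> N (z - u0) <= delta].
Proof.
move=> eps0 b0 phiL.
have [f [lf fN fexp]] := strongly_exposing_perturbation eps0.
have fB u v : `|f u - f v| <= eps * N (u - v).
  by have -> : f u - f v = f (u - v); rewrite ?fN // [u - v]addrC -scaleN1r lf; ring.
have /choice[alp alpP] : forall n, exists alpha, 0 < alpha /\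
    forall z z', almost_maximizers f alpha z -> almost_maximizers f alpha z' ->
      N (z - z') <= 1 / 2 ^+ n.
  move=> n; have [|alpha a0 aP] := fexp (1 / 2 ^+ n); last by exists alpha.
  by rewrite divr_gt0 // exprn_gt0.
have /choice[z zP] : forall n, exists z, almost_maximizers f (alp n) z.
  move=> n; have [a0 _] := alpP n.
  exact: almost_maximizers_nonempty fN (ltW eps0) a0.
have [||u0 u0P] := @complN z (fun n => 1 / 2 ^+ n).
(* The depths need not decrease, but of two consecutive slices the deeper one contains both
   points. *)
- move=> n; have [le_a|/ltW le_a] := leP (alp n.+1) (alp n).
    have [_] := alpP n; apply; last exact: zP.
    exact: almost_maximizersS le_a _ (zP _).
  have [_ aP] := alpP n.+1; apply: le_trans (aP _ _ (zP _) _) _.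
    exact: almost_maximizersS le_a _ (zP _).
  by rewrite exprS invfM !mul1r ler_piMl ?invr_ge0 ?exprn_ge0 // invf_le1 // ler1n.
- by move=> n; rewrite exprS invfM !mul1r mulrC.
have near delta : 0 < delta -> exists2 alpha, 0 < alpha &
    forall y, almost_maximizers f alpha y -> N (y - u0) <= delta.
  (* In units of [1 / 2 ^+ n], the 3 is 1 for the slice diameter plus 2 for the distance from [z n]
     to [u0]. *)
  move=> d0; have [n hn] := exists_div_pow2_le (ler0n R 3) d0.
  have [a0 aP] := alpP n; exists (alp n) => // y fy.
  apply: le_trans (norm_triangle (z n) _ _) _; apply: le_trans hn.
  by have := aP _ _ fy (zP n); have := u0P n; lra.
have key alpha delta : 0 < alpha -> 0 < delta ->
    exists2 y, almost_maximizers f alpha y & N (y - u0) <= delta.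
  move=> a0 /near[a' a'0 a'P].
  have m0 : 0 < Num.min alpha a' by rewrite lt_min a0.
  have [y fy] := almost_maximizers_nonempty fN (ltW eps0) m0.
  exists y; first by apply: almost_maximizersS fy; rewrite ge_min lexx.
  by apply: a'P; apply: almost_maximizersS fy; rewrite ge_min lexx orbT.
have lip y : `|(phi y + f y) - (phi u0 + f u0)| <= (b + eps) * N (y - u0).
  rewrite opprD addrACA mulrDl; apply: le_trans (ler_normD _ _) _.
  exact: lerD.
have be0 : 0 < b + eps by rewrite ltr_wpDl.
have max_u0 y : D y -> phi y + f y <= phi u0 + f u0.
  move=> Dy; apply/ler_addgt0Pr => r r0.
  have [||x [Dx fx] xu] := key (r / 2) (r / 2 / (b + eps)); rewrite ?divr_gt0 //.
  have := fx _ Dy; have := lip x.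
  have : (b + eps) * N (x - u0) <= r / 2 by rewrite mulrC -ler_pdivlMr.
  by rewrite ler_norml; lra.
exists f, u0; split=> //.
  by move=> delta d0; have [y [Dy _] yu] := key 1 delta ltr01 d0; exists y.
move=> delta /near[a a0 aP]; exists a => // y Dy hy; apply: aP; split=> // x Dx.
by have := max_u0 _ Dx; lra.
Qed.

End Variational.

(** * Normed modules over the real or complex scalars *)

(** Restriction of scalars along [io]; a separate name keeps the real module structure apart from
    the one over [K]. *)
Definition realified (R : realType) (K : numFieldType) (io : {rmorphism R -> K})
  (Z : lmodType K) : Type := Z.

Section Realified.
Variables (R : realType) (K : numFieldType) (io : {rmorphism R -> K}) (Z : lmodType K).
Local Notation E := (realified io Z).

HB.instance Definition _ := GRing.Zmodule.on E.

Let scale (r : R) (z : E) : E := io r *: (z : Z).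

Let scaleA a b (z : E) : scale a (scale b z) = scale (a * b) z.
Proof. by rewrite /scale scalerA rmorphM. Qed.

Let scale1 : left_id 1 scale.
Proof. by move=> z; rewrite /scale rmorph1 scale1r. Qed.

Let scaleDr : right_distributive scale +%R.
Proof. by move=> a y z; exact: scalerDr. Qed.

Let scaleDl (z : E) : {morph scale^~ z : a b / a + b}.
Proof. by move=> a b; rewrite /scale rmorphD scalerDl. Qed.

HB.instance Definition _ :=
  GRing.Zmodule_isLmodule.Build R E scaleA scale1 scaleDr scaleDl.

Lemma realified_scaleE (r : R) (z : Z) : r *: (z : E) = io r *: z.
Proof. by []. Qed.

End Realified.

(* Covers both scalar fields: [io] embeds the reals in [K], [re] is the real part. *)
Record real_part_structure (R : realType) (K : numFieldType) (io : {rmorphism R -> K})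
    (re : K -> R) : Prop := RealPartStructure {
  io_le : forall r s, (io r <= io s) = (r <= s);
  re_io : forall r, re (io r) = r;
  reD : forall k l, re (k + l) = re k + re l;
  reM : forall r k, re (io r * k) = r * re k;
  io_re : forall k, 0 <= k -> io (re k) = k;
  re_norm : forall k, re k <= re `|k|;
  unit_circle_compact : forall theta : nat -> K, (forall n, `|theta n| = 1) ->
    exists2 sigma : nat -> nat, increasing_seq sigma & exists theta0,
      forall r, 0 < r -> exists n0, forall n, (n0 <= n)%N ->
        re `|theta (sigma n) - theta0| <= r;
  complexify : forall (Z : lmodType K) (f : realified io Z -> R), scalar f ->
    exists2 F : Z -> K, scalar F & forall z, re (F z) = f z }.

Section Scalars.
Variables (R : realType) (K : numFieldType) (io : {rmorphism R -> K}) (re : K -> R).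
Hypothesis H : real_part_structure io re.

Lemma io_norm r : `|io r| = io `|r|.
Proof.
have io0 s : 0 <= s -> `|io s| = io s.
  by move=> s0; rewrite ger0_norm // -(rmorph0 io) (io_le H).
have [r0|r0] := ger0P r; first by rewrite io0.
by rewrite -normrN -rmorphN io0 ?oppr_ge0 // ltW.
Qed.

Lemma io_gt0 r : (0 < io r) = (0 < r).
Proof. by rewrite -(rmorph0 io) !lt_def !(io_le H) (inj_eq (fmorph_inj io)). Qed.

Lemma re_gt0 k : 0 < k -> 0 < re k.
Proof. by move=> k0; rewrite -io_gt0 (io_re H) // ltW. Qed.

Definition rnorm (Z : normedModType K) (z : Z) : R := re `|z|.

Lemma io_rnorm (Z : normedModType K) (z : Z) : io (rnorm z) = `|z|.
Proof. by rewrite (io_re H). Qed.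

Lemma rnorm_le (Z : normedModType K) (z : Z) r : (rnorm z <= r) = (`|z| <= io r).
Proof. by rewrite -(io_le H) io_rnorm. Qed.

Lemma rnormZ (Z : normedModType K) k (z : Z) : rnorm (k *: z) = re `|k| * rnorm z.
Proof. by rewrite /rnorm normrZ -[in LHS](io_re H (normr_ge0 k)) (reM H). Qed.

Lemma rnorm_is_norm (Z : normedModType K) :
  is_norm (@rnorm Z : realified io Z -> R).
Proof.
split=> [u v|t u|u u0].
- rewrite -(io_le H) rmorphD !io_rnorm; exact: ler_normD.
- by rewrite realified_scaleE rnormZ io_norm (re_io H).
- by apply/eqP; rewrite -normr_eq0 -(io_rnorm u) u0 rmorph0.
Qed.

Lemma rnorm_unitZ (Z : normedModType K) k (z : Z) : `|k| = 1 -> rnorm (k *: z) = rnorm z.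
Proof. by move=> k1; rewrite /rnorm normrZ k1 mul1r. Qed.

Lemma cvg_rnormP (Z : normedModType K) (x : nat -> Z) (l : Z) :
  x n @[n --> \oo] --> l <-> forall r, 0 < r -> exists n0, forall n, (n0 <= n)%N ->
    rnorm (x n - l) <= r.
Proof.
split=> [/cvgrPdist_le xl r r0|xl].
  have [|n0 _ hn] := xl (io r); first by rewrite io_gt0.
  by exists n0 => n n0n; rewrite rnorm_le distrC; exact: hn.
apply/cvgrPdist_le => e e0; have ioe := io_re H (ltW e0).
have [n0 hn] := xl _ (re_gt0 e0); exists n0 => // n n0n /=.
by rewrite distrC -ioe -rnorm_le; exact: hn.
Qed.

Lemma complete_rnorm (Z : completeNormedModType K) :
  geometrically_complete (@rnorm Z : realified io Z -> R).
Proof.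
move=> x c xc cc.
have normN := rnorm_is_norm Z.
have c0 n : 0 <= c n by apply: le_trans (xc n); exact: norm_ge0 normN _.
(* The subtracted term lets the induction close, as [c k <= 2 * c k - 2 * c k.+1]. *)
have dist n m : rnorm (x (n + m)%N - x n) <= 2 * c n - 2 * c (n + m)%N.
  elim: m => [|m IHm]; first by rewrite addn0 !subrr /rnorm normr0 -(rmorph0 io) (re_io H).
  rewrite addnS; apply: le_trans (norm_triangle normN (x (n + m)%N) _ _) _.
  by have := xc (n + m)%N; have := cc (n + m)%N; lra.
have dist' n m : (n <= m)%N -> rnorm (x m - x n) <= 2 * c n.
  by move=> /subnKC <-; apply: le_trans (dist _ _) _; have := c0 (n + (m - n))%N; lra.
have c_small r : 0 < r -> exists n, 2 * c n <= r.
  move=> r0; have [n hn] := exists_div_pow2_le (mulr_ge0 (ler0n R 2) (c0 0%N)) r0.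
  exists n; apply: (le_trans _ hn) => {hn}; elim: n => [|n IHn]; first by rewrite expr0 divr1.
  by rewrite exprS invfM; have := cc n; lra.
have /cvg_ex[/= l xl] : cvg (x @ \oo).
  apply/cauchy_cvgP; apply: cauchy_exP => e e0; have ioe := io_re H (ltW e0).
  have [n hn] := c_small (re e / 2) (divr_gt0 (re_gt0 e0) (ltr0n _ 2)).
  exists (x n); exists n => // m nm /=; rewrite -ball_normE /=.
  have : `|x n - x m| <= io (re e / 2).
    by rewrite distrC -rnorm_le; apply: le_trans (dist' _ _ nm) _.
  move=> /le_lt_trans; apply; rewrite rmorphM fmorphV rmorph_nat ioe.
  by rewrite gtr_pMr // invf_lt1 ?ltr0n // ltr1n.
exists l => n; apply/ler_addgt0Pr => r r0.
have [m hm] := (cvg_rnormP _ _).1 xl r r0.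
apply: le_trans (norm_triangle normN (x (maxn n m)) _ _) _.
apply: lerD; last by apply: hm; exact: leq_maxr.
by rewrite (norm_dist normN); apply: dist'; exact: leq_maxl.
Qed.

(** By induction on the tree, a closed convex set containing the far points contains every
    barycenter of them, hence so does the closed hull. *)
Lemma rnp_tree_dentable (Z : completeNormedModType K) :
  radon_nikodym_property Z -> tree_dentable (@rnorm Z : realified io Z -> R).
Proof.
move=> rnp A A0 [M AM] delta d0.
have [||a Aa nhull] := rnp A A0 _ (io delta).
- exists (io M); split; first by rewrite realE -(rmorph0 io) !(io_le H); exact: le_total.
  by move=> x Mx a Aa /=; apply: le_trans (ltW Mx); rewrite -rnorm_le AM.
- by rewrite io_gt0.
exists a => // s ls sa; apply: nhull => C [[_ cC] AC].
have {sa}<- := sa; elim: s ls => [z /= [Az dz]|t l IHl r IHr /= [/andP[t0 t1] /IHl Cl /IHr Cr]].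
  apply: AC; split=> //= zd.
  move: zd; rewrite -io_rnorm => /[dup] /ltW; rewrite (io_le H) => zd1 zd2.
  have E : rnorm (z - a) = delta by apply/eqP; rewrite eq_le zd1.
  by move: zd2; rewrite E ltxx.
have t0' : 0 <= io t by rewrite -(rmorph0 io) (io_le H).
have t1' : io t <= 1 by rewrite -(rmorph1 io) (io_le H).
have /set_mem := cC _ _ (Itv01 t0' t1') (mem_set Cl) (mem_set Cr).
by rewrite !realified_scaleE rmorphB rmorph1.
Qed.

(** An upper bound in [K] dominates some norm, so it is nonnegative and equals [io] of its real
    part; leastness can thus be checked in [R]. *)
Lemma operator_norm_eq (X Y : normedModType K) (S : X -> Y) P :
  (forall x, unit_ball X x -> rnorm (S x) <= P) ->
  (forall r, 0 < r -> exists2 x, unit_ball X x & P - r <= rnorm (S x)) ->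
  operator_norm S = io P.
Proof.
move=> SP PS; rewrite /operator_norm /supremum ifF; last first.
  apply/negbTE/set0P; have [x xb _] := PS 1 ltr01.
  by exists `|S x|, x.
apply: xget_subset1; last exact: is_subset1_supremums.
split=> [_ [x xb <-]|y yub]; first by rewrite -rnorm_le SP.
have y0 : 0 <= y.
  by have [x xb _] := PS 1 ltr01; apply: le_trans (normr_ge0 (S x)) _; apply: yub; exists x.
rewrite -(io_re H y0) (io_le H); apply/ler_addgt0Pr => r r0.
have [x xb xP] := PS _ r0.
have : rnorm (S x) <= re y by rewrite rnorm_le (io_re H) //; apply: yub; exists x.
lra.
Qed.

Lemma unit_ball0 (X : normedModType K) : unit_ball X 0.
Proof. by rewrite /unit_ball /= normr0. Qed.

Lemma operator_norm_le (X Y : normedModType K) (S : X -> Y) c :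
  (forall x, unit_ball X x -> rnorm (S x) <= c) -> operator_norm S <= io c.
Proof.
move=> Sc; pose E := [set rnorm (S x) | x in unit_ball X].
have E0 : E !=set0 by exists (rnorm (S 0)), 0 => //; exact: unit_ball0.
have ubE : has_ubound E by exists c => _ [x xb <-]; exact: Sc.
rewrite (@operator_norm_eq _ _ S (sup E)).
- by rewrite (io_le H); apply: ge_sup => // _ [x xb <-]; exact: Sc.
- by move=> x xb; apply: ub_le_sup => //; exists x.
- move=> r r0; have [_ [x xb <-] /ltW h] := sup_adherent r0 (conj E0 ubE).
  by exists x.
Qed.

Lemma exists_bounded_operator (X Y : normedModType K) (g : X -> Y) c : linear g ->
  (forall x, unit_ball X x -> rnorm (g x) <= c) ->
  exists S : bounded_operator X Y, forall x, S x = g x.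
Proof.
move=> lg gc.
pose gl : {linear X -> Y} := HB.pack g (GRing.isLinear.Build K X Y *:%R g lg).
have bg : [bounded gl x | x in unit_ball X].
  exists (io c); split; first by rewrite realE -(rmorph0 io) !(io_le H); exact: le_total.
  by move=> x cx z zb /=; apply: le_trans (ltW cx); rewrite -rnorm_le; exact: gc.
by exists (BoundedOperator bg).
Qed.

Lemma bounded_operator_rnorm (X Y : normedModType K) (T : bounded_operator X Y) :
  exists2 c, 0 <= c & forall x, rnorm (T x) <= c * rnorm x.
Proof.
have [M [Mr TM]] := bounded_operatorP T.
have M0 : 0 <= M + 1.
  by apply: le_trans (TM (M + 1) _ 0 (unit_ball0 X)); rewrite ?ltrDl.
have Tc x : unit_ball X x -> rnorm (T x) <= re (M + 1).
  by move=> xb; rewrite rnorm_le (io_re H) //; apply: TM => //; rewrite ltrDl.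
exists (re (M + 1)).
  by rewrite -(io_le H) rmorph0 (io_re H).
move=> x; have [->|x0] := eqVneq x 0.
  by rewrite linear0 /rnorm !normr0 -(rmorph0 io) (re_io H) mulr0.
have rx0 : rnorm x != 0.
  by apply: contraNneq x0 => rx; rewrite -normr_eq0 -io_rnorm rx rmorph0.
have rx : 0 < rnorm x by rewrite lt_neqAle eq_sym rx0 (norm_ge0 (rnorm_is_norm X)).
have rV : rnorm (io (rnorm x)^-1 *: x) = 1.
  by rewrite rnormZ io_norm (re_io H) gtr0_norm ?invr_gt0 // mulVf.
have := Tc (io (rnorm x)^-1 *: x).
rewrite linearZ rnormZ io_norm (re_io H) gtr0_norm ?invr_gt0 // ler_pdivrMl // mulrC.
by apply; rewrite /unit_ball /= -io_rnorm rV rmorph1.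
Qed.

End Scalars.

(** * Perturbation of operators *)

Section Approximation.
Variables (R : realType) (K : numFieldType) (io : {rmorphism R -> K}) (re : K -> R).
Hypothesis H : real_part_structure io re.
Local Notation N := (rnorm re).

Lemma unimodular_rotation k : exists2 t : K, `|t| = 1 & t * k = `|k|.
Proof.
have [->|k0] := eqVneq k 0; first by exists 1; rewrite ?normr1 ?mulr0 ?normr0.
have nk0 : `|k| != 0 by rewrite normr_eq0.
by exists (`|k| / k); [rewrite normf_div normr_id divff | rewrite mulfVK].
Qed.

Lemma zero_uniquely_quasi_norm_attaining (X Y : normedModType K)
    (S : bounded_operator X Y) : (forall x, S x = 0) -> uniquely_quasi_norm_attaining S.
Proof.
move=> S0; exists 0 => x xb _; exists id; first by [].
exists 1; first exact: normr1.
under eq_fun do rewrite S0.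
by rewrite scaler0; exact: cvg_cst.
Qed.

Theorem approximation_by_factorization (X : normedModType K) (Z : completeNormedModType K)
    (Y : normedModType K) (A : {linear X -> Z}) (B : {linear Z -> Y})
    (T : bounded_operator X Y) (a b r : R) :
  radon_nikodym_property Z -> (forall x, T x = B (A x)) ->
  0 <= a -> (forall x, N (A x) <= a * N x) ->
  0 <= b -> (forall z, N (B z) <= b * N z) -> 0 < r ->
  exists2 S : bounded_operator X Y, uniquely_quasi_norm_attaining S &
    operator_norm (S \- T) <= io r.
Proof.
move=> rnpZ TBA a0 AN b0 BN r0.
have normZ := rnorm_is_norm H Z.
have normY := rnorm_is_norm H Y.
have ballP x : unit_ball X x <-> N x <= 1 by rewrite (rnorm_le H) rmorph1.
pose D := [set A x | x in unit_ball X] : set (realified io Z).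
pose phi (z : realified io Z) : R := N (B z).
have D0 : D !=set0 by exists (A 0), 0 => //; exact: unit_ball0.
have Da v : D v -> N (v : Z) <= a.
  move=> [x /ballP x1 <-]; apply: le_trans (AN x) _.
  by rewrite ler_piMr.
have phiL (u v : realified io Z) : `|phi u - phi v| <= b * N (u - v : Z).
  have h (u' v' : Z) : phi u' - phi v' <= b * N (u' - v').
    have := norm_triangle normY (B v') (B u') 0; rewrite !subr0 /phi.
    by have := BN (u' - v'); rewrite linearB /=; lra.
  rewrite ler_norml h andbT; have := h v u.
  by rewrite (norm_dist normZ); lra.
have phiM v : D v -> phi v <= Num.max a (b * a).
  move=> Dv; rewrite le_max; apply/orP; right; apply: le_trans (BN _) _.
  by apply: ler_wpM2l => //; exact: Da.
have DM v : D v -> N (v : Z) <= Num.max a (b * a) by move=> /Da h; rewrite le_max h.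
(* The error will be at most [eps * (2 * a) <= r]; the added 1 covers [a = 0]. *)
pose eps := r / (2 * a + 1).
have a1 : 0 < 2 * a + 1 by lra.
have eps0 : 0 < eps by rewrite divr_gt0.
have [f [u0 [lf fN fmax Du0 fexp]]] := strongly_exposed_point normZ (rnp_tree_dentable H rnpZ)
  (complete_rnorm H (Z := Z)) D0 DM phiM eps0 b0 phiL.
set P := phi u0 + f u0 in fmax fexp.
have [F lF reF] := complexify H (Z := Z) lf.
(* Rotating [z] until [F] is real and nonnegative turns the real part [f] into the modulus of
   [F]. *)
have FN (z : Z) : exists2 t, `|t| = 1 & re `|F z| = f (t *: z).
  have [t t1 tF] := unimodular_rotation (F z); exists t => //.
  have FZ : F (t *: z) = t * F z.
    by have := lF t z 0; rewrite !addr0 (scalar0 lF) addr0.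
  by rewrite -reF FZ tF.
have Drot t z : `|t| = 1 -> D z -> D (t *: (z : Z)).
  move=> t1 [x xb <-]; exists (t *: x); last by rewrite linearZ.
  by rewrite /unit_ball /= normrZ t1 mul1r.
have F_le (z : Z) : re `|F z| <= eps * N z.
  have [t t1 ->] := FN z; apply: le_trans (ler_norm _) _.
  by apply: le_trans (fN _) _; rewrite rnorm_unitZ.
have phi_rot t (z : Z) : `|t| = 1 -> phi (t *: z) = phi z.
  by move=> t1; rewrite /phi linearZ rnorm_unitZ.
(* Both [D] and [phi] are rotation invariant, so the bound on [phi + f] also holds for [phi] plus
   the modulus of [F]. *)
have phiF z : D z -> phi z + re `|F z| <= P.
  move=> Dz; have [t t1 ->] := FN z.
  by rewrite -(phi_rot t _ t1); apply: fmax; exact: Drot.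
have Nu0 : N (u0 : Z) <= a.
  apply/ler_addgt0Pr => d d0; have [z Dz zu] := Du0 d d0.
  have := norm_triangle normZ z u0 0; rewrite !subr0 (norm_dist normZ).
  by have := Da z Dz; lra.
have epsa : eps * (2 * a) <= r.
  by rewrite /eps mulrAC ler_pdivrMr //; apply: ler_wpM2l; [exact: ltW | lra].
(* If [B u0] vanishes, then [P = f u0], so [phi (A x) <= f u0 - f (A x) <= 2 * eps * a] and the zero
   operator is close enough to [T]. *)
have [Bu0|Bu0] := eqVneq (N (B u0)) 0.
  have [S S0] : exists S : bounded_operator X Y, forall x, S x = 0.
    apply: (exists_bounded_operator H (c := 0)) => [k u w|x _].
      by rewrite scaler0 addr0.
    by rewrite (norm0 normY).
  exists S; first exact: zero_uniquely_quasi_norm_attaining.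
  apply: (operator_norm_le H) => x xb; rewrite /= S0 sub0r.
  rewrite (normN_opp normY) TBA; have DAx : D (A x) by exists x.
  have : phi (A x) + f (A x) <= P := fmax _ DAx.
  have := fN (A x); have := fN u0; rewrite !ler_norml /P /phi Bu0.
  have := ler_wpM2l (ltW eps0) (Da _ DAx); have := ler_wpM2l (ltW eps0) Nu0.
  by lra.
pose v : Y := io (N (B u0))^-1 *: B u0.
have nv : N v = 1.
  rewrite (rnormZ H) (io_norm H) (re_io H) ger0_norm ?mulVf //.
  by rewrite invr_ge0 (norm_ge0 normY).
pose S' (z : Z) : Y := B z + F z *: v.
have lS' : linear S'.
  move=> k z w; rewrite /S' linearP lF scalerDl scalerDr !scalerA.
  by rewrite addrACA.
have NFv z : N (F z *: v) = re `|F z| by rewrite (rnormZ H) nv mulr1.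
have S'D z : D z -> N (S' z) <= phi z + re `|F z|.
  by move=> Dz; have [ND _ _] := normY; rewrite -NFv; exact: ND.
have S'L (z w : Z) : N (S' z - S' w) <= (b + eps) * N (z - w).
  have -> : S' z - S' w = S' (z - w).
    by rewrite (_ : z - w = -1 *: w + z) ?lS' scaleN1r addrC.
  have [ND _ _] := normY; apply: le_trans (ND _ _) _.
  by rewrite NFv mulrDl; apply: lerD.
(* The vector [S' u0] is a multiple of [B u0] whose norm is the modulus of [io (N (B u0)) + F u0], a
   scalar with real part [P]. *)
have S'u0 : P <= N (S' u0).
  have -> : S' u0 = (1 + F u0 * io (N (B u0))^-1) *: B u0.
    by rewrite scalerDl scale1r -scalerA.
  rewrite (rnormZ H) mulrC -(reM H).
  have -> : io (N (B u0)) * `|1 + F u0 * io (N (B u0))^-1| = `|io (N (B u0)) + F u0|.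
    rewrite -[X in io X * _](ger0_norm (norm_ge0 normY (B u0))) -(io_norm H) -normrM.
    by rewrite mulrDr mulr1 mulrCA -rmorphM mulfV // rmorph1 mulr1.
  by apply: le_trans (re_norm H _); rewrite (reD H) (re_io H) reF.
have DA x : unit_ball X x -> D (A x) by move=> xb; exists x.
have S'AP x : unit_ball X x -> N (S' (A x)) <= P.
  by move=> /DA Dx; apply: le_trans (S'D _ Dx) (phiF _ Dx).
have [S SE] : exists S : bounded_operator X Y, forall x, S x = S' (A x).
  by apply: (exists_bounded_operator H _ S'AP) => k x y; rewrite linearP lS'.
have normS : operator_norm S = io P.
  apply: (operator_norm_eq H) => [x xb|d d0]; first by rewrite SE S'AP.
  have [|_ [x xb <-] xu] := Du0 (d / (b + eps)); first by rewrite divr_gt0 // ltr_wpDl.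
  exists x => //; rewrite SE.
  have := norm_triangle normY (S' (A x)) (S' u0) 0; rewrite !subr0.
  have := S'L (A x) u0; rewrite (norm_dist normY).
  by move: xu; rewrite ler_pdivlMr ?ltr_wpDl // mulrC; lra.
exists S; last first.
  apply: (operator_norm_le H) => x xb; rewrite /= SE TBA /S' addrAC subrr add0r NFv.
  apply: le_trans (F_le _) _; apply: le_trans epsa; apply: ler_wpM2l; first exact: ltW.
  by have := Da _ (DA _ xb); lra.
exists (S' u0) => x xb; rewrite normS => /cvgrPdist_le Sx.
have ev d : 0 < d -> exists n0, forall n, (n0 <= n)%N -> P - d <= N (S' (A (x n))).
  rewrite -(io_gt0 H) => /Sx[n0 _ hn]; exists n0 => n n0n.
  have := hn n n0n; rewrite /= SE -(io_rnorm H) -rmorphB (io_norm H) (io_le H).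
  by rewrite ler_norml; lra.
have /choice[theta thetaP] : forall n, exists t, `|t| = 1 /\
    re `|F (A (x n))| = f (t *: A (x n)).
  by move=> n; have [t t1 tF] := FN (A (x n)); exists t.
(* At the rotated point [phi + f] is at least the norm of [S' (A (x n))], hence close to [P], and
   strong exposedness applies. *)
have near d : 0 < d -> exists n0, forall n, (n0 <= n)%N ->
    N (theta n *: A (x n) - u0 : Z) <= d.
  move=> /fexp[al al0 alP]; have [n0 hn] := ev _ al0; exists n0 => n n0n.
  have [t1 tF] := thetaP n; apply: alP; first by apply: Drot => //; exact: DA.
  rewrite (phi_rot _ _ t1) -tF; apply: le_trans (hn n n0n) _.
  by apply: S'D; exact: DA.
have [sigma sigmaI [theta0 th]] := unit_circle_compact H (fun n => (thetaP n).1).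
have th1 : `|theta0| = 1.
  have normK := rnorm_is_norm H K^o.
  rewrite -(rmorph1 io) -(io_re H (normr_ge0 theta0)); congr (io _).
  apply/eqP; rewrite -subr_eq0 -normr_le0; apply/ler_addgt0Pr => d /th[n0 /(_ n0 (leqnn _)) hn].
  rewrite add0r; apply: le_trans hn.
  have := norm_triangle normK (theta (sigma n0)) theta0 0.
  have := norm_triangle normK theta0 (theta (sigma n0)) 0.
  rewrite !subr0 (norm_dist normK theta0) /rnorm (thetaP _).1.
  by rewrite -(rmorph1 io) (re_io H) ler_norml; lra.
(* Along [sigma] the points [theta0 *: A (x n)] tend to [u0], so undoing the rotation gives the
   limit of the images. *)
exists sigma => //; exists theta0^-1; first by rewrite normfV th1 invr1.
have th0 : theta0 != 0 by rewrite -normr_eq0 th1 oner_eq0.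
apply/(cvg_rnormP H) => d d0.
(* A share [d' * a] pays for replacing [theta] by its limit and [d'] for the distance to [u0];
   [b + eps] is the Lipschitz constant of [S']. *)
pose d' := d / ((b + eps) * (a + 1)).
have be0 : 0 < b + eps by rewrite ltr_wpDl.
have ba0 : 0 < (b + eps) * (a + 1) by rewrite mulr_gt0 // ltr_wpDl.
have d'0 : 0 < d' by rewrite divr_gt0.
have [n1 hn1] := near _ d'0; have [n2 hn2] := th _ d'0.
exists (maxn n1 n2) => n; rewrite geq_max => /andP[n1n n2n].
have -> : S (x (sigma n)) - theta0^-1 *: S' u0 =
    theta0^-1 *: (S' (theta0 *: A (x (sigma n))) - S' u0).
  have S'Z k z : S' (k *: z) = k *: S' z.
    have S'0 : S' 0 = 0 by have := lS' (-1) 0 0; rewrite scaler0 addr0 scaleN1r addNr.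
    by have := lS' k z 0; rewrite !addr0 S'0 addr0.
  by rewrite scalerBr S'Z scalerA mulVf // scale1r SE.
rewrite rnorm_unitZ ?normfV ?th1 ?invr1 //; apply: le_trans (S'L _ _) _.
have h4 : N (theta0 *: A (x (sigma n)) - u0 : Z) <=
    re `|theta (sigma n) - theta0| * N (A (x (sigma n))) +
    N (theta (sigma n) *: A (x (sigma n)) - u0 : Z).
  rewrite distrC -(rnormZ H) scalerBl; exact: (norm_triangle normZ).
have h1 := hn1 _ (leq_trans n1n (increasing_seq_ge_id sigmaI n)).
have h2 : re `|theta (sigma n) - theta0| * N (A (x (sigma n))) <= d' * a.
  apply: ler_pM; [exact: (norm_ge0 (rnorm_is_norm H K^o)) | exact: (norm_ge0 normZ) | exact: hn2 |].
  exact: Da (DA _ (xb _)).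
have h3 : (b + eps) * (d' * (a + 1)) = d by rewrite /d'; field; rewrite !lt0r_neq0 // ltr_wpDl.
rewrite -h3 ler_pM2l //; lra.
Qed.

End Approximation.

(** * Density over both scalar fields *)

Theorem rnp_dense (R : realType) (K : numFieldType) (io : {rmorphism R -> K})
    (re : K -> R) (X Y : completeNormedModType K) :
  real_part_structure io re ->
  radon_nikodym_property X \/ radon_nikodym_property Y ->
  dense_in_operator_norm
    [set T : bounded_operator X Y | uniquely_quasi_norm_attaining T].
Proof.
move=> H rnp T e e0; have ioe := io_re H (ltW e0).
have r20 : 0 < re e / 2 by rewrite divr_gt0 // (re_gt0 H).
have lt_e : io (re e / 2) < e.
  by rewrite rmorphM fmorphV rmorph_nat ioe gtr_pMr // invf_lt1 ?ltr0n // ltr1n.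
have [c c0 Tc] := bounded_operator_rnorm H T.
have id1 (V : normedModType K) (v : V) : rnorm re v <= 1 * rnorm re v by rewrite mul1r.
case: rnp => rnp.
  have [S SU ST] := approximation_by_factorization (A := idfun) (B := T) (T := T)
    H rnp (fun=> erefl) ler01 (id1 _) c0 Tc r20.
  by exists S => //; exact: le_lt_trans lt_e.
have [S SU ST] := approximation_by_factorization (A := T) (B := idfun) (T := T)
  H rnp (fun=> erefl) c0 Tc ler01 (id1 _) r20.
by exists S => //; exact: le_lt_trans lt_e.
Qed.

Lemma bounded_subsequence (R : realType) (u : nat -> R) c : (forall n, `|u n| <= c) ->
  exists2 sigma : nat -> nat, increasing_seq sigma & exists l,
    forall r, 0 < r -> exists n0, forall n, (n0 <= n)%N -> `|u (sigma n) - l| <= r.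
Proof.
move=> uc; have [|s si /cvg_ex[/= l /cvgrPdist_le sl]] := bolzano_weierstrass (u_ := u).
  exists c; split; first by rewrite num_real.
  by move=> x cx n _ /=; apply: le_trans (uc n) (ltW cx).
exists s => //; exists l => r /sl[n0 _ hn]; exists n0 => n n0n.
by rewrite distrC; exact: hn.
Qed.

Lemma real_structure (R : realType) :
  real_part_structure (idfun : {rmorphism R -> R}) id.
Proof.
split=> // [k|theta th|Z f lf]; first exact: ler_norm.
  by apply: (@bounded_subsequence _ _ 1) => n; rewrite th.
by exists f.
Qed.

Local Open Scope complex_scope.

Lemma complex_structure (R : realType) :
  real_part_structure (real_complex R : {rmorphism R -> R[i]}) (@complex.Re R).
Proof.
have Re_le (k : R[i]) : `|complex.Re k| <= complex.Re `|k|.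
  by case: k => x y /=; rewrite -sqrtr_sqr ler_wsqrtr // lerDl sqr_ge0.
have Im_le (k : R[i]) : `|complex.Im k| <= complex.Re `|k|.
  by case: k => x y /=; rewrite -sqrtr_sqr ler_wsqrtr // lerDr sqr_ge0.
have le_ReIm (k : R[i]) : complex.Re `|k| <= `|complex.Re k| + `|complex.Im k|.
  case: k => x y /=; rewrite -[leRHS]ger0_norm ?addr_ge0 // -sqrtr_sqr ler_wsqrtr //.
  rewrite sqrrD !real_normK ?num_real // -subr_ge0.
  rewrite [X in 0 <= X](_ : _ = `|x| * `|y| *+ 2); last by ring.
  by rewrite mulrn_wge0 // mulr_ge0.
split=> [r s|r|[x y] [x' y']|r [x y]|[x y]|k|theta th|Z f lf] //=.
- by rewrite lecR.
- by rewrite mul0r subr0.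
- by rewrite lecE /= => /andP[/eqP-> _].
- exact: le_trans (ler_norm _) (Re_le k).
- have bR n : `|complex.Re (theta n)| <= 1 by have := Re_le (theta n); rewrite th.
  have bI n : `|complex.Im (theta n)| <= 1 by have := Im_le (theta n); rewrite th.
  have [s1 i1 [x hx]] := bounded_subsequence bR.
  have [s2 i2 [y hy]] := bounded_subsequence (fun n => bI (s1 n)).
  (* The second extraction is made from the imaginary parts along [s1], so the composite serves both
     coordinates. *)
  exists (s1 \o s2) => [m n|]; first by rewrite /= i1 -leEnat i2.
  exists (x +i* y) => r r0; have r20 : 0 < r / 2 by rewrite divr_gt0.
  have [n1 h1] := hx _ r20; have [n2 h2] := hy _ r20.
  exists (maxn n1 n2) => n; rewrite geq_max => /andP[n1n n2n].
  have := h1 _ (leq_trans n1n (increasing_seq_ge_id i2 n)); have := h2 _ n2n.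
  have := le_ReIm (theta (s1 (s2 n)) - x +i* y).
  case: (theta _) => p q /=; lra.
have fD (z w : Z) : f (z + w) = f z + f w.
  by have := lf 1 z w; rewrite realified_scaleE rmorph1 scale1r mul1r.
have fZ (r : R) (z : Z) : f (r%:C *: z) = r * f z.
  by have := lf r z 0; rewrite realified_scaleE !addr0 (scalar0 lf) addr0.
(* The usual complexification: the imaginary part is forced by [F ('i *: z) = 'i * F z]. *)
exists (fun z => f z -i* f ('i *: z)) => // -[x y] z w.
have E : x +i* y = x%:C + y%:C * 'i by rewrite [LHS]complexE [in LHS]mulrC.
have Z1 : f ((x +i* y) *: z) = x * f z + y * f ('i *: z).
  by rewrite E scalerDl -scalerA fD !fZ.
have Z2 : f ('i *: ((x +i* y) *: z)) = x * f ('i *: z) - y * f z.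
  rewrite scalerA E mulrDr ['i * x%:C]mulrC mulrCA -expr2 sqr_i mulrN1 -rmorphN.
  by rewrite scalerDl -scalerA fD !fZ mulNr.
rewrite scalerDr !fD Z1 Z2; apply/eqP; rewrite eq_complex /=.
by apply/andP; split; apply/eqP; ring.
Qed.

Theorem corollary3p10 (R : realType) :
  (forall X Y : completeNormedModType R,
     radon_nikodym_property X \/ radon_nikodym_property Y ->
     dense_in_operator_norm
       [set T : bounded_operator X Y | uniquely_quasi_norm_attaining T]) /\
  (forall X Y : completeNormedModType R[i],
     radon_nikodym_property X \/ radon_nikodym_property Y ->
     dense_in_operator_norm
       [set T : bounded_operator X Y | uniquely_quasi_norm_attaining T]).
Proof.
split=> X Y; first exact: rnp_dense (real_structure R).
exact: rnp_dense (complex_structure R).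
Qed.
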